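(* Let $X$ be a Polish space with a fixed (arbitrary) compatible metric and let $\varepsilon>0$. Then $E^{CC,\varepsilon}_X \sim_B E^A_{\mathcal{C}_\varepsilon(X)}$.
   Context: A continuum is a nonempty compact connected metrizable space (single points are continua); an arc is a homeomorphic copy of $[0,1]$. $\mathcal{C}(X)$ is the hyperspace of all continua contained in $X$, with the Vietoris topology (induced by the Hausdorff metric), and $\mathcal{C}_\varepsilon(X)=\{K\in\mathcal{C}(X):\operatorname{diam}(K)<\varepsilon\}$ with the subspace topology. The relation $E_X^{CC,\varepsilon}$ on $X$ is: $x\,E_X^{CC,\varepsilon}\,y$ iff there are $k\in\mathbb{N}$ and $K_0,\dots,K_k\in\mathcal{C}_\varepsilon(X)$ such that $x\in K_0$, $y\in K_k$ and $K_i\cap K_{i+1}\ne\emptyset$ for $0\le i<k$. For a metrizable space $Z$, the arc-connection relation $E_Z^A$ on $Z$ is $x\,E_Z^A\,y$ iff $x=y$ or there is an arc in $Z$ containing $x$ and $y$. For equivalence relations $E,F$ on standard Borel spaces $X,Y$ (not necessarily Borel relations), $E\leq_B F$ means that there is a Borel map $f:X\to Y$ with $xEy\iff f(x)Ff(y)$ for all $x,y\in X$, and $E\sim_B F$ means $E\leq_B F$ and $F\leq_B E$. *)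

(* Defs.v *)
From HB Require Import structures.
From mathcomp Require Import all_boot all_order all_algebra.
From mathcomp Require Import all_classical all_reals all_analysis.

Set Implicit Arguments.
Unset Strict Implicit.
Unset Printing Implicit Defensive.

Import Order.TTheory GRing.Theory Num.Theory.
Import numFieldNormedType.Exports.

Local Open Scope classical_set_scope.
Local Open Scope ring_scope.

Definition separable (T : topologicalType) : Prop :=
  exists2 D : set T, countable D & dense D.

Definition is_metric (R : realType) (T : Type) (d : T -> T -> R) : Prop :=
  [/\ forall x y, 0 <= d x y,
      forall x y, d x y = 0 <-> x = y,
      forall x y, d x y = d y x &
      forall x y z, d x z <= d x y + d y z].

Definition metric_compatible (R : realType) (T : topologicalType)
    (d : T -> T -> R) : Prop :=
  forall (x : T) (A : set T),
    nbhs x A <-> exists2 e : R, 0 < e & [set y | d x y < e] `<=` A.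

Definition metric_complete (R : realType) (T : topologicalType)
    (d : T -> T -> R) : Prop :=
  forall u : nat -> T,
    (forall e : R, 0 < e ->
      exists N, forall m n, (N <= m)%N -> (N <= n)%N -> d (u m) (u n) < e) ->
    exists l : T, u @ \oo --> l.

Definition completely_metrizable (R : realType) (T : topologicalType) : Prop :=
  exists d : T -> T -> R,
    [/\ is_metric d, metric_compatible d & metric_complete d].

(* The space may be empty.  When [T] is a [metricType], the complete metric
   need not be [mdist]. *)
Definition polish (R : realType) (T : topologicalType) : Prop :=
  separable T /\ completely_metrizable R T.

Record continuum (T : topologicalType) : Type := Continuum {
  continuum_set :> set T;
  continuum_nonempty : continuum_set !=set0;
  continuum_compact : compact continuum_set;
  continuum_connected : connected continuum_set
}.

HB.instance Definition _ (T : topologicalType) := gen_eqMixin (continuum T).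
HB.instance Definition _ (T : topologicalType) := gen_choiceMixin (continuum T).

(* Subbasic set of the Vietoris topology coded by [i], for [i.2] open: the
   continua contained in [i.2] or, according to [i.1], those meeting [i.2]. *)
Definition vietoris_subbase (T : topologicalType) (i : bool * set T) :
    set (continuum T) :=
  if i.1 then [set K | K `<=` i.2] else [set K | K `&` i.2 !=set0].

HB.instance Definition _ (T : topologicalType) :=
  @isSubBaseTopological.Build (continuum T) (bool * set T)%type
    [set i | open i.2] (@vietoris_subbase T).

(* An extended real, so that unbounded sets have diameter [+oo]; only used for
   nonempty sets ([diam set0] is [-oo]). *)
Definition diam (R : realType) (X : metricType R) (A : set X) : \bar R :=
  ereal_sup [set (mdist p.1 p.2)%:E | p in A `*` A].

(* As a type, this set carries the subspace topology of [continuum X]. *)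
Definition small_continua (R : realType) (X : metricType R) (eps : R) :
    set (continuum X) :=
  [set K | (diam K < eps%:E)%E].

Definition chain_rel (R : realType) (X : metricType R) (eps : R) (x y : X) :
    Prop :=
  exists (k : nat) (K : nat -> continuum X),
    [/\ forall i, (i <= k)%N -> small_continua eps (K i),
        (K 0%N : set X) x,
        (K k : set X) y &
        forall i, (i < k)%N -> K i `&` K i.+1 !=set0].

Definition homeomorphic (S T : topologicalType) : Prop :=
  exists (f : S -> T) (g : T -> S),
    [/\ continuous f, continuous g, cancel f g & cancel g f].

Definition is_arc (R : realType) (Z : topologicalType) (A : set Z) : Prop :=
  homeomorphic (set_type (`[0 : R, 1]%classic)) (set_type A).

Definition arc_rel (R : realType) (Z : topologicalType) (x y : Z) : Prop :=
  x = y \/ exists A : set Z, [/\ is_arc R A, A x & A y].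

(* Measurability for the Borel sigma-algebras; [measurable_fun] would require
   both spaces to be pointed, hence nonempty. *)
Definition borel_map (S T : topologicalType) (f : S -> T) : Prop :=
  forall B : set T, <<s @open T >> B -> <<s @open S >> (f @^-1` B).

Definition borel_reducible (S T : topologicalType)
    (E : S -> S -> Prop) (F : T -> T -> Prop) : Prop :=
  exists2 f : S -> T, borel_map f & forall x y, E x y <-> F (f x) (f y).

Definition borel_bireducible (S T : topologicalType)
    (E : S -> S -> Prop) (F : T -> T -> Prop) : Prop :=
  borel_reducible E F /\ borel_reducible F E.

(* Main.v *)
(* Key point: for small continua K, L and points x in K, y in L, there is a
   chain of small continua from x to y iff K and L are joined by an arc in the
   hyperspace.  The two reductions are then x |-> {x} and a Borel selector
   K |-> f(K) in K.

   Arcs give chains: along an arc t |-> K_t, all K_s with s near t lie in a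
   common open set whose subcontinua are small, and the union of the K_s over
   a subinterval is a continuum, since K_s is continuous in s.

   Chains give arcs: if x in K, there is an order arc from {x} to K, consisting
   of subcontinua of K and hence of small continua.  It is a maximal chain of
   continua between {x} and K.  A Whitney map is injective on it, and its image
   is an interval because between two nested continua there is always a third
   one.  Arcs in a Hausdorff space concatenate: follow the first one until it
   meets the second. *)
Require Import Defs.
From HB Require Import structures.
From mathcomp Require Import all_boot all_order all_algebra.
From mathcomp Require Import all_classical all_reals all_analysis.
From mathcomp Require Import zify lra.

Set Implicit Arguments.
Unset Strict Implicit.
Unset Printing Implicit Defensive.

Import Order.TTheory GRing.Theory Num.Theory.
Import numFieldNormedType.Exports.

Local Open Scope classical_set_scope.
Local Open Scope ring_scope.

(** * Continua and the Vietoris topology *)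

Lemma continuum_inj (T : topologicalType) (K L : continuum T) :
  K = L :> set T -> K = L.
Proof.
case: K L => [K K0 cK nK] [L L0 cL nL] /= KL; move: KL K0 cK nK => -> *.
by congr Continuum; exact: Prop_irrelevance.
Qed.

Lemma vietoris_subbase_open (T : topologicalType) (i : bool * set T) :
  open i.2 -> open (vietoris_subbase i).
Proof.
move=> oi; exists [set vietoris_subbase i].
  by move=> _ ->; exact: finI_from1.
by rewrite bigcup_set1.
Qed.

Lemma open_vietoris_sub (T : topologicalType) (U : set T) :
  open U -> open [set K : continuum T | K `<=` U].
Proof. exact: (@vietoris_subbase_open _ (true, U)). Qed.

Lemma open_vietoris_meet (T : topologicalType) (U : set T) :
  open U -> open [set K : continuum T | K `&` U !=set0].
Proof. exact: (@vietoris_subbase_open _ (false, U)). Qed.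

(** Subbasic sets are enough because a filter is closed under finite intersections. *)
Lemma cvg_vietoris (T : topologicalType) (F : set_system (continuum T))
    (K : continuum T) : Filter F ->
  (forall U, open U -> K `<=` U -> F [set L | L `<=` U]) ->
  (forall U, open U -> K `&` U !=set0 -> F [set L | L `&` U !=set0]) ->
  F --> K.
Proof.
move=> FF Fsub Fmeet.
have FV (i : bool * set T) :
    open i.2 -> vietoris_subbase i K -> F (vietoris_subbase i).
  by rewrite /vietoris_subbase; case: ifP => _; [exact: Fsub|exact: Fmeet].
move=> A; rewrite nbhsE => -[B [[D' D'fin <-] [C D'C CK]] BA].
have [I sI CE] := D'fin _ D'C.
suff : F C by apply: filterS => L CL; apply: BA; exists C.
rewrite -CE; apply: filter_bigI => i iI.
apply: FV; first exact: (set_mem (sI i iI)).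
by move: CK; rewrite -CE; apply.
Qed.

(** * Directed intersections of compact sets and of continua *)

(** Complete normality of metric spaces. Around each point take half of a ball that misses the other
    set; if two such half balls met, the larger of the two full balls would contain the centre of
    the other. *)
Lemma separated_open (R : realType) (X : metricType R) (A B : set X) :
  separated A B -> exists U V,
    [/\ open U, open V, A `<=` U, B `<=` V & U `&` V = set0].
Proof.
pose N (C D : set X) := [set z | exists2 x, C x & exists2 r : R,
  ball x r `&` D = set0 & mdist x z < r / 2].
have NO C D : open (N C D).
  rewrite openE => z [x Cx [r xrD xzr]]; rewrite /interior.
  apply/nbhs_ballP; exists (r / 2 - mdist x z) => /=; first by rewrite subr_gt0.
  move=> y; rewrite ballEmdist/= => zy; exists x => //; exists r => //.
  by rewrite (le_lt_trans (metric_triangle _ z _))// -ltrBrDl.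
have NS C D : C `&` closure D = set0 -> C `<=` N C D.
  move=> CD x Cx; exists x => //.
  have : ~ closure D x by move=> Dx; have : set0 x by rewrite -CD.
  move=> /existsNP[B' /not_implyP[/nbhs_ballP[r /= r0 xrB] DB]].
  exists r; last by rewrite mdistxx divr_gt0.
  apply/seteqP; split => // y [/xrB By Dy]; case: DB; by exists y.
move=> [AB BA]; exists (N A B), (N B A); split => //.
- exact: NS.
- by apply: NS; rewrite setIC.
- apply/seteqP; split => // z [[x Ax [r xrB xz]] [y By [s ysA yz]]].
  have xy : mdist x y < r / 2 + s / 2.
    rewrite (le_lt_trans (metric_triangle _ z _))// ltrD// metric_sym//.
  have [rs|/ltW sr] := leP r s.
    suff : set0 x by [].
    rewrite -ysA; split => //; rewrite ballEmdist/=.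
    rewrite metric_sym (lt_le_trans xy)//; lra.
  suff : set0 y by [].
  rewrite -xrB; split => //; rewrite ballEmdist/=.
  rewrite (lt_le_trans xy)//; lra.
Qed.

Lemma mdist_continuous (R : realType) (X : metricType R) (p : X) :
  continuous (mdist p : X -> R).
Proof.
move=> x; apply/cvgrPdist_lt => e e0.
apply/nbhs_ballP; exists e => //= y; rewrite ballEmdist/= => xy.
rewrite ltr_norml; have := metric_triangle p x y.
have := metric_triangle p y x; rewrite (metric_sym y x); lra.
Qed.

Lemma continuum_closed (R : realType) (X : metricType R) (K : continuum X) :
  closed (K : set X).
Proof.
by apply: compact_closed; [exact: metric_hausdorff|exact: continuum_compact].
Qed.

(** Otherwise the sets [A] minus [U] generate a proper filter on a compact set. A cluster point lies
    in every [A], hence in the open set [U], which the filter avoids. *)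
Lemma directed_bigcap_sub_open (T : topologicalType) (F : set (set T))
    (U : set T) : hausdorff_space T -> F !=set0 ->
  (forall A B, F A -> F B -> exists2 C, F C & C `<=` A `&` B) ->
  (forall A, F A -> compact A) -> open U ->
  \bigcap_(A in F) A `<=` U -> exists2 A, F A & A `<=` U.
Proof.
move=> hT [A0 FA0] dirF cF oU FU; apply: contrapT => nFU.
pose G := filter_from F (fun A => A `\` U).
have GF : ProperFilter G.
  apply: filter_from_proper.
    apply: filter_from_filter; first by exists A0.
    move=> A B FA FB; have [C FC CAB] := dirF _ _ FA FB.
    by exists C => // x [/CAB[Ax Bx] nUx].
  move=> A FA; apply: contrapT => AU; apply: nFU; exists A => // x Ax.
  by apply: contrapT => nUx; apply: AU; exists x.
have GA0 : G A0 by exists A0 => //; exact: subDsetl.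
have [x [A0x Gx]] := cF _ FA0 G GF GA0.
have Ux : U x.
  apply: FU => A FA; apply: (compact_closed hT (cF _ FA)) => B xB.
  have [|y [[Ay _] By]] := Gx (A `\` U) B _ xB; first by exists A.
  by exists y.
have [||y [[_ nUy] Uy]] := Gx (A0 `\` U) U; [by exists A0| |by []].
exact: open_nbhs_nbhs.
Qed.

(** A separation of [C] extends to disjoint open sets, whose union already contains some member [A].
    The contradiction is left as a hypothesis because it has two sources: connected members in a
    chain of continua, and clopen members in a quasi-component. *)
Lemma directed_bigcap_connected (R : realType) (X : metricType R)
    (F : set (set X)) (C := \bigcap_(A in F) A) : F !=set0 ->
  (forall A B, F A -> F B -> exists2 C, F C & C `<=` A `&` B) ->
  (forall A, F A -> compact A) ->
  (forall A U V, F A -> open U -> open V -> U `&` V = set0 ->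
    A `<=` U `|` V -> C `&` U !=set0 -> C `&` V !=set0 -> False) ->
  connected C.
Proof.
move=> F0 dirF cF FUV; apply: contrapT => /connectedPn[E [E0 CE sE]].
have [U [V [oU oV EU EV UV0]]] := separated_open sE.
have [|||A FA AUV] := @directed_bigcap_sub_open _ F (U `|` V) _ F0 dirF cF.
- exact: metric_hausdorff.
- exact: openU.
- by rewrite -/C CE; exact: setUSS.
apply: (FUV _ _ _ FA oU oV UV0 AUV); rewrite CE.
- by have [x Ex] := E0 false; exists x; split; [left|exact: EU].
- by have [x Ex] := E0 true; exists x; split; [right|exact: EV].
Qed.

Lemma connected_openU (T : topologicalType) (A U V : set T) :
  connected A -> open U -> open V -> U `&` V = set0 -> A `<=` U `|` V ->
  A `&` U !=set0 -> A `<=` U.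
Proof.
move=> cA oU oV UV0 AUV AU.
suff <- : A `&` U = A by exact: subIsetr.
apply: cA => //; first by exists U.
exists (~` V); first exact: open_closedC.
apply/seteqP; split => x [Ax].
  by move=> Ux; split => // Vx; have : set0 x by rewrite -UV0.
by move=> nVx; split => //; have [] := AUV _ Ax.
Qed.

Lemma chain_directed (T : topologicalType) (S : set (continuum T)) :
  (forall K L : continuum T, S K -> S L -> K `<=` L \/ L `<=` K) ->
  let F := [set (K : set T) | K in S] in
  forall A B, F A -> F B -> exists2 C, F C & C `<=` A `&` B.
Proof.
move=> totS F _ _ [K SK <-] [L SL <-].
have [KL|LK] := totS _ _ SK SL.
- by exists K; [exists K|move=> x Kx; split => //; exact: KL].
- by exists L; [exists L|move=> x Lx; split => //; exact: LK].
Qed.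

Lemma chain_bigcap_sub_open (R : realType) (X : metricType R)
    (S : set (continuum X)) (U : set X) : S !=set0 ->
  (forall K L : continuum X, S K -> S L -> K `<=` L \/ L `<=` K) ->
  open U -> \bigcap_(K in S) (K : set X) `<=` U ->
  exists2 K : continuum X, S K & K `<=` U.
Proof.
move=> [K0 SK0] totS oU SU.
have [|||_ [K SK <-] KU] := directed_bigcap_sub_open
    (@metric_hausdorff _ X) _ (chain_directed totS) _ oU.
- by exists K0, K0.
- by move=> _ [K _ <-]; exact: continuum_compact.
- by rewrite bigcap_image.
- by exists K.
Qed.

Lemma continuum_bigcap (R : realType) (X : metricType R)
    (S : set (continuum X)) : S !=set0 ->
  (forall K L : continuum X, S K -> S L -> K `<=` L \/ L `<=` K) ->
  exists C : continuum X, C = \bigcap_(K in S) K :> set X.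
Proof.
move=> [K0 SK0] totS; pose F := [set (K : set X) | K in S].
have FE : \bigcap_(A in F) A = \bigcap_(K in S) K :> set X.
  by rewrite bigcap_image.
rewrite -FE.
(* Were the intersection empty, some member would be contained in the open set [set0]. *)
have I0 : \bigcap_(A in F) A !=set0.
  rewrite FE; apply: contrapT => /nonemptyPn SI0.
  have [||K _ K0'] := chain_bigcap_sub_open _ totS open0.
  - by exists K0.
  - by rewrite SI0.
  - by have [y /K0'] := continuum_nonempty K.
have cI : compact (\bigcap_(A in F) A).
  apply: (@subclosed_compact _ _ K0); last 2 first.
  - exact: continuum_compact.
  - by apply: bigcap_inf; exists K0.
  - apply: closed_bigI => A FA.
    by case: FA => K _ <-; exact: continuum_closed.
have conI : connected (\bigcap_(A in F) A).
  apply: directed_bigcap_connected; [by exists K0, K0|exact: chain_directed|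
    by move=> _ [K _ <-]; exact: continuum_compact|].
  move=> _ U V [K SK <-] oU oV UV0 KUV.
  move=> [x [Ix Ux]] [y [Iy Vy]].
  have /(_ y) : K `<=` U.
    apply: (connected_openU _ oU oV) => //; first exact: continuum_connected.
    by exists x; split => //; apply: Ix; exists K.
  move=> /(_ (Iy _ (ex_intro2 _ _ K SK erefl))) Uy.
  by have : set0 y by rewrite -UV0.
by exists (Continuum I0 cI conI).
Qed.

(** The common point [x] makes the union connected; its closure is compact because it stays in
    [K]. *)
Lemma continuum_closure_bigcup (R : realType) (X : metricType R)
    (S : set (continuum X)) (x : X) (K : continuum X) : S !=set0 ->
  (forall L : continuum X, S L -> (L : set X) x /\ L `<=` K) ->
  exists C : continuum X, C = closure (\bigcup_(L in S) L) :> set X.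
Proof.
move=> [L0 SL0] SxK.
have U0 : closure (\bigcup_(L in S) (L : set X)) !=set0.
  exists x; apply: subset_closure; exists L0 => //.
  by have [] := SxK _ SL0.
have cU : compact (closure (\bigcup_(L in S) (L : set X))).
  apply: (@subclosed_compact _ _ K); first exact: closed_closure.
    exact: continuum_compact.
  have cK := @continuum_closed _ _ K.
  rewrite [X in _ `<=` X](closure_id _).1//; apply: closureS.
  by move=> y [L SL Ly]; have [_] := SxK _ SL; exact.
have conU : connected (closure (\bigcup_(L in S) (L : set X))).
  apply: connected_closure; apply: bigcup_connected.
    by exists x => L SL; have [] := SxK _ SL.
  by move=> L _; exact: continuum_connected.
by exists (Continuum U0 cU conU).
Qed.

(** * Boundary bumping: continua between two nested continua *)

(** This margin serves twice: as the radius of the ball removed in boundary bumping, and for the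
    strict monotonicity of the Whitney map. *)
Lemma continuum_gap (R : realType) (X : metricType R) (A B : continuum X) :
  A `<=` B -> A <> B -> exists p (r : R),
    [/\ (B : set X) p, 0 < r & forall y, (A : set X) y -> r < mdist p y].
Proof.
move=> AB nAB.
have [p [Bp nAp]] : exists p, (B : set X) p /\ ~ (A : set X) p.
  apply: contrapT => nBA; apply: nAB; apply: continuum_inj.
  apply/seteqP; split => // p Bp; apply: contrapT => nAp.
  by apply: nBA; exists p.
have : nbhs p (~` (A : set X)).
  by apply: open_nbhs_nbhs; split => //; exact/closed_openC/continuum_closed.
move=> /nbhs_ballP[r /= r0 prA]; exists p, (r / 2).
split; rewrite ?divr_gt0// => y Ay; rewrite ltNge; apply/negP => pyr.
apply: (prA y) => //.
by rewrite ballEmdist/= (le_lt_trans pyr)// gtr_pMr// invf_lt1// ltr1n.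
Qed.

(* Boundary bumping: C is the quasi-component of A in B minus a ball that is
   disjoint from A.  If C were A, a relatively clopen neighbourhood of A in that
   set would be clopen in B. *)
Lemma continuum_between (R : realType) (X : metricType R) (A B : continuum X) :
  A `<=` B -> A <> B ->
  exists C : continuum X, [/\ A `<=` C, C `<=` B, C <> A & C <> B].
Proof.
move=> AB nAB.
have hX := @metric_hausdorff _ X.
have cB := @continuum_compact _ B.
have [p [r [Bp r0 prA]]] := continuum_gap AB nAB.
have cd := @mdist_continuous _ _ p.
pose G := [set y | r <= mdist p y].
have clG : closed G.
  have -> : G = mdist p @^-1` [set t | r <= t] by [].
  by apply: preimage_closed => [? _|]; [exact: cd|exact: closed_ge].
have oG : open [set y | r < mdist p y].
  have -> : [set y | r < mdist p y] = mdist p @^-1` [set t | r < t] by [].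
  by apply: open_comp => [? _|]; [exact: cd|exact: open_gt].
have clG' : closed [set y | mdist p y <= r].
  have -> : [set y | mdist p y <= r] = mdist p @^-1` [set t | t <= r] by [].
  by apply: preimage_closed => [? _|]; [exact: cd|exact: closed_le].
(* Relatively clopen neighbourhoods of [A] in the intersection of [B] and [G]; the second condition
   expresses relative openness. *)
pose F := [set D : set X | [/\ compact D, closed ((B `&` G) `\` D),
  A `<=` D & D `<=` B `&` G]].
have clB := @continuum_closed _ _ B.
have FBG : F (B `&` G).
  split => //; first exact: compact_closedI.
    by rewrite setDv; exact: closed0.
  by move=> y Ay; split; [exact: AB|exact/ltW/prA].
have F0 : F !=set0 by exists (B `&` G).
have dirF D E : F D -> F E -> exists2 C, F C & C `<=` D `&` E.
  move=> [cD oD AD DBG] [cE oE AE EBG]; exists (D `&` E) => //; split.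
  - by apply: compact_closedI => //; exact: compact_closed.
  - by rewrite setDIr; exact: closedU.
  - by move=> y Ay; split; [exact: AD|exact: AE].
  - by move=> y [/DBG].
have cF D : F D -> compact D by case.
pose C := \bigcap_(D in F) D.
have AC : A `<=` C by move=> y Ay D [_ _ + _]; exact.
have C0 : C !=set0 by have [x /AC] := continuum_nonempty A; exists x.
have CBG : C `<=` B `&` G by move=> y; exact.
have cC : compact C.
  apply: (@subclosed_compact _ _ (B `&` G)) => //; last exact: cF.
  by apply: closed_bigI => D [cD _ _ _]; exact: compact_closed.
have conC : connected C.
  apply: directed_bigcap_connected => // D U V FD oU oV UV0 DUV CU CV.
  wlog AU : U V oU oV UV0 DUV CU CV / A `&` U !=set0.
    move=> wl; have [x Ax] := continuum_nonempty A.
    have [_ _ AD _] := FD.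
    have [Ux|Vx] := DUV _ (AD _ Ax).
      by apply: (wl U V) => //; exists x.
    apply: (wl V U) => //; first by rewrite setIC.
      by rewrite setUC.
    by exists x.
  have [cD oD AD DBG] := FD.
  have {}AU : A `<=` U.
    apply: (connected_openU _ oU oV) => //; first exact: continuum_connected.
    exact: subset_trans DUV.
  have DU : D `&` U = D `\` V.
    apply/seteqP; split => x [Dx].
      by move=> Ux; split => // Vx; have : set0 x by rewrite -UV0.
    by move=> nVx; split => //; have [] := DUV _ Dx.
  (* As [D] is split by the disjoint open sets [U] and [V], its part in [U] is still relatively
     clopen. Hence [C] lies in [U], against [CV]. *)
  have FDU : F (D `&` U).
    split.
    - by rewrite DU setDE; apply: compact_closedI => //; exact: open_closedC.
    - rewrite setDIr; apply: closedU => //.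
      by rewrite setDE; apply: closedI; [exact: closedI|exact: open_closedC].
    - by move=> y Ay; split; [exact: AD|exact: AU].
    - by move=> y [/DBG].
  have [y [Cy Vy]] := CV.
  have [_ Uy] := Cy _ FDU.
  by have : set0 y by rewrite -UV0.
exists (Continuum C0 cC conC); split => //=.
- by move=> y /CBG[].
- move=> /(congr1 (@continuum_set _))/= CA.
  have [|D [cD oD AD DBG] DG] :=
    @directed_bigcap_sub_open _ F _ hX F0 dirF cF oG.
    by rewrite -/C CA => y /prA.
  (* [D] is closed and avoids the closed ball of radius [r] about [p]. Its complement in [B] is
     therefore the union of two closed sets: the part of [B] in that ball, and the rest of [B] in
     [G]. So [D] is clopen in the connected set [B]. *)
  have DB : D = B.
    apply: (@continuum_connected _ B).
    + by have [x /AD] := continuum_nonempty A; exists x.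
    + exists (~` ((B `&` G `\` D) `|` (B `&` [set y | mdist p y <= r]))).
        by apply: closed_openC; apply: closedU => //; exact: closedI.
      apply/seteqP; split => [y Dy|y [By]].
        split; first by have [] := DBG _ Dy.
        case => [[_ nDy]//|[_]]/=.
        by rewrite leNgt (DG _ Dy).
      move=> /not_orP[nBGD nBr]; apply: contrapT => nDy.
      have [ry|/ltW yr] := leP r (mdist p y); first by apply: nBGD.
      exact: nBr.
    + exists D; first exact: compact_closed.
      by apply/esym/setIidPr => y /DBG[].
  by have := DG p; rewrite DB => /(_ Bp); rewrite /= mdistxx ltNge (ltW r0).
- move=> /(congr1 (@continuum_set _))/= CB.
  by have : C p; [rewrite CB|move=> /CBG[_]; rewrite /G/= mdistxx leNgt r0].
Qed.

(** * Whitney maps *)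

(** The point [x0] excludes the empty space, on which there is no sequence. *)
Lemma separable_dense_seq (R : realType) (X : metricType R) (x0 : X) :
  separable X ->
  exists q : nat -> X, forall x (e : R), 0 < e -> exists n, mdist (q n) x < e.
Proof.
move=> [D /pfcard_geP[D0|[q]] dD].
  by have [|y []] := dD setT _ openT; [exists x0|rewrite D0].
exists q => x e e0.
have [||y [xy Dy]] := dD (ball x e)°; last 1 first.
- have [n _ qn] := @surj _ _ _ _ q y Dy; exists n; rewrite qn metric_sym.
  by move: (interior_subset xy); rewrite ballEmdist.
- by exists x; exact: nbhsx_ballx.
- exact: open_interior.
Qed.

Section sup_image.
Context {R : realType} {X : metricType R}.
Variable f : X -> R.
Hypothesis cf : continuous f.

Lemma sup_image_max (K : continuum X) :
  (exists2 x, (K : set X) x & sup (f @` K) = f x) /\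
  (forall x, (K : set X) x -> f x <= sup (f @` K)).
Proof.
have [c] := compact_EVT_max (continuum_nonempty K) (@continuum_compact _ K)
  (continuous_subspaceT cf).
rewrite inE => Kc fc.
have -> : sup (f @` K) = f c.
  apply/eqP; rewrite eq_le; apply/andP; split.
    apply: ge_sup; first by exists (f c), c.
    by move=> _ [x Kx <-]; apply: fc; rewrite inE.
  apply: ub_le_sup; last by exists c.
  by exists (f c) => _ [x Kx <-]; apply: fc; rewrite inE.
by split; [exists c|move=> x Kx; apply: fc; rewrite inE].
Qed.

(** The two kinds of subbasic sets give the two bounds: continua inside a sublevel set bound the
    maximum from above, continua meeting a superlevel set bound it from below. *)
Lemma continuous_sup_image : continuous (fun K : continuum X => sup (f @` K)).
Proof.
move=> K; apply/(@cvgrPdist_lt _ _ _ _ (nbhs_filter K)) => e e0.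
have [[c Kc supK] leK] := sup_image_max K.
have upper : nbhs K [set L : continuum X |
    L `<=` f @^-1` [set t | t < sup (f @` K) + e]].
  apply: open_nbhs_nbhs; split.
    apply: open_vietoris_sub; apply: open_comp => [? _|]; first exact: cf.
    exact: open_lt.
  by move=> x Kx; rewrite /= (le_lt_trans (leK _ Kx))// ltrDl.
have lower : nbhs K [set L : continuum X |
    L `&` (f @^-1` [set t | sup (f @` K) - e < t]) !=set0].
  apply: open_nbhs_nbhs; split.
    apply: open_vietoris_meet; apply: open_comp => [? _|]; first exact: cf.
    exact: open_gt.
  by exists c; split => //=; rewrite -supK ltrBlDr ltrDl.
apply: (@filterS2 _ _ (nbhs_filter K) _ _ _ _ upper lower).
move=> L Lsup [x [Lx /= xK]].
have [[d Ld supL] leL] := sup_image_max L.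
have := leL _ Lx; have := Lsup d Ld; rewrite /= -supL ltr_norml; lra.
Qed.

End sup_image.

Lemma continuous_scalel (R : realType) (T : topologicalType) (u : T -> R) a :
  continuous u -> continuous (fun x => u x * a).
Proof. by move=> cu x; apply: cvgM; [exact: cu|exact: cvg_cst]. Qed.

Lemma continuous_series (R : realType) (T : topologicalType) (u : nat -> T -> R)
    (n : nat) : (forall k, continuous (u k)) ->
  continuous (fun x => series (u ^~ x) n).
Proof.
move=> cu; rewrite /series/=; elim: n => [|n IH].
  by under eq_fun do rewrite big_geq//; exact: cst_continuous.
under eq_fun do rewrite big_nat_recr//=.
by move=> x; apply: cvgD; [exact: IH|exact: cu].
Qed.

(** The map is the sum over [n] of the maximum on [K] of [f n], weighted by the [n]-th power of 1/2,
    where [f n] decreases with the distance to the [n]-th point of a dense sequence. Uniform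
    convergence gives continuity; density gives strictness. *)
Lemma whitney_map (R : realType) (X : metricType R) : separable X ->
  exists2 w : continuum X -> R, continuous w &
    forall A B : continuum X, A `<=` B -> A <> B -> w A < w B.
Proof.
move=> sX; have [[x0 _]|noX] := pselect (exists x : X, True); last first.
  exists (fun=> 0); first exact: cst_continuous.
  by move=> A; have [x] := continuum_nonempty A; case: noX; exists x.
have [q qd] := separable_dense_seq x0 sX.
pose f n (y : X) := (1 + mdist (q n) y)^-1.
have f_pos n y : 0 < 1 + mdist (q n) y by rewrite ltr_pwDl// mdist_ge0.
have cf n : continuous (f n).
  move=> y; apply: cvgV; first exact: lt0r_neq0.
  by apply: cvgD; [exact: cvg_cst|exact: mdist_continuous].
pose u K n := sup (f n @` (K : continuum X)) * 2^-1 ^+ n.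
have uK (K : continuum X) n :
    exists2 x, (K : set X) x & u K n = f n x * 2^-1 ^+ n.
  have [[x Kx supK] _] := sup_image_max (cf n) K.
  by exists x => //; rewrite /u supK.
have h_ge0 n : 0 <= 2^-1 ^+ n :> R by rewrite exprn_ge0// invr_ge0.
have u_ge0 K n : 0 <= u K n.
  have [x _ ->] := uK K n.
  by rewrite mulr_ge0// invr_ge0 ltW.
have u_le K n : u K n <= 2^-1 ^+ n.
  have [x _ ->] := uK K n.
  by rewrite ler_piMl// invf_le1// lerDl mdist_ge0.
have mono (A B : continuum X) n : A `<=` B -> u A n <= u B n.
  move=> AB; have [x Ax ->] := uK A n; rewrite ler_wpM2r//.
  by have [_] := sup_image_max (cf n) B; apply; exact: AB.
have cvu K : cvgn (series (u K)).
  apply: (@series_le_cvg _ _ (geometric 1 2^-1)) => //.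
  - by move=> n; rewrite /= mul1r.
  - by move=> n; rewrite /= mul1r.
  - by apply: is_cvg_geometric_series; rewrite ger0_norm// invf_lt1// ltr1n.
have nd K : nondecreasing_seq (series (u K)).
  by apply/nondecreasing_seqP => n; rewrite seriesSr lerDl.
(* The added term is the sum of the geometric tail from index [n] on. It bounds the error of the
   partial sums uniformly in [K]. *)
have ni K : nonincreasing_seq (fun n => series (u K) n + 2 * 2^-1 ^+ n).
  apply/nonincreasing_seqP => n; rewrite seriesSr exprS.
  have := u_le K n; lra.
pose w K := limn (series (u K)).
have w_ge K n : series (u K) n <= w K by exact: nondecreasing_cvgn_le.
have w_le K n : w K <= series (u K) n + 2 * 2^-1 ^+ n.
  apply: limr_le; first exact: cvu.
  near=> m; have nm : (n <= m)%N by near: m; exists n.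
  by apply: le_trans (ni K _ _ nm); rewrite lerDl mulr_ge0.
exists w.
  move=> K; apply/(@cvgrPdist_lt _ _ _ _ (nbhs_filter K)) => e e0.
  have [n ne] : exists n, 2 * 2^-1 ^+ n < e / 3 :> R.
    have : (fun n => 2 * 2^-1 ^+ n : R) @ \oo --> (2 * 0 : R).
      apply: cvgM; [exact: cvg_cst|apply: cvg_expr].
      by rewrite ger0_norm// invf_lt1// ltr1n.
    rewrite mulr0 => /cvgrPdist_lt/(_ (e / 3)); case; first by rewrite divr_gt0.
    move=> n _ /(_ n (leqnn n)); rewrite sub0r normrN ger0_norm ?mulr_ge0//.
    by exists n.
  have cS : continuous (fun L => series (u L) n).
    apply: (@continuous_series _ (continuum X) (fun k L => u L k)) => k.
    apply: (@continuous_scalel _ (continuum X)); exact: continuous_sup_image.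
  have := (@cvgrPdist_lt _ _ _ _ (nbhs_filter K) _ _).1 (cS K) (e / 3).
  rewrite divr_gt0// => /(_ isT).
  apply: (@filterS _ _ (nbhs_filter K)) => L; rewrite !ltr_norml.
  have := w_ge K n; have := w_ge L n; have := w_le K n; have := w_le L n; lra.
move=> A B AB nAB.
have [p [r [Bp r0 prA]]] := continuum_gap AB nAB.
(* All points of [A] are farther than [r / 2] from this [q n], while [p] is closer, so the [n]-th
   terms differ strictly. *)
have [n qp] := qd p (r / 2) (divr_gt0 r0 (ltr0Sn _ _)).
have un : u A n < u B n.
  have [a Aa ->] := uK A n.
  rewrite ltr_pM2r ?exprn_gt0 ?invr_gt0//.
  have [_ /(_ p Bp)] := sup_image_max (cf n) B; apply: lt_le_trans.
  rewrite ltf_pV2 ?posrE// ltrD2l (lt_trans qp)//.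
  have := metric_triangle p (q n) a; rewrite (metric_sym p (q n)).
  have := prA _ Aa; lra.
rewrite -subr_gt0 in un.
(* The gap in the [n]-th term survives in the limit because all other terms are ordered the right
   way. *)
suff : w A <= w B - (u B n - u A n) by lra.
apply: limr_le; first exact: cvu.
near=> m; have nm : (n < m)%N by near: m; exists n.+1.
apply: (@le_trans _ _ (series (u B) m - (u B n - u A n))); last first.
  by rewrite lerD2r.
move: nm; clear -mono AB; elim: m => // m IH.
rewrite ltnS leq_eqVlt => /orP[/eqP<-|nm].
  have : series (u A) n <= series (u B) n by apply: ler_sum => i _; exact: mono.
  by rewrite !seriesSr; lra.
have := IH nm; have := mono _ _ m AB; rewrite !seriesSr; lra.
Unshelve. all: by end_near. Qed.

(** * Order arcs from maximal chains *)

Definition singleton_continuum (T : topologicalType) (x : T) : continuum T :=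
  Continuum (ex_intro [set x] x erefl) (@compact_set1 _ x) (@connected1 _ x).

(** Zorn's lemma for inclusion. Maximality is put in the form in which it is applied below: a
    continuum is placed in the chain by comparing it with every member. *)
Lemma maximal_chain (T : topologicalType) (P : set (continuum T)) :
  exists C : set (continuum T),
    [/\ C `<=` P,
        forall A B : continuum T, C A -> C B -> A `<=` B \/ B `<=` A &
        forall D : continuum T, P D ->
          (forall A : continuum T, C A -> A `<=` D \/ D `<=` A) -> C D].
Proof.
pose Q (C : set (continuum T)) := C `<=` P /\
  forall A B : continuum T, C A -> C B -> A `<=` B \/ B `<=` A.
have [|C [[CP totC] maxC]] := @Zorn_bigcup _ Q.
  move=> F FQ totF; split; first by move=> A [C /FQ[CP _]]; exact: CP.
  move=> A B [C FC CA] [D FD DB].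
  have [/(_ _ CA) DA|/(_ _ DB) CB] := totF _ _ FC FD.
  - by have [_] := FQ _ FD; apply.
  - by have [_] := FQ _ FC; apply.
exists C; split => // D PD totD; apply: contrapT => nCD.
apply: (maxC (D |` C)).
  split; first by move=> A CA; right.
  by move=> /(_ D) CD; apply: nCD; apply: CD; left.
split; first by move=> A [->//|]; exact: CP.
move=> A B [->|CA] [->|CB]; [by left| | |exact: totC].
- by have [] := totD _ CB; [right|left].
- exact: totD.
Qed.

Lemma continuous_limit_ge (R : realType) (T : topologicalType) (w : T -> R)
    (F : set_system T) (x : T) (t : R) : ProperFilter F -> continuous w ->
  F --> x -> F [set y | t <= w y] -> t <= w x.
Proof. by move=> FF cw Fx; apply: cvgr_to_ge; exact: cvg_comp Fx (cw x). Qed.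

Lemma continuous_limit_le (R : realType) (T : topologicalType) (w : T -> R)
    (F : set_system T) (x : T) (t : R) : ProperFilter F -> continuous w ->
  F --> x -> F [set y | w y <= t] -> w x <= t.
Proof. by move=> FF cw Fx; apply: cvgr_to_le; exact: cvg_comp Fx (cw x). Qed.

Section order_arc.
Context {R : realType} {X : metricType R}.
Variables (K : continuum X) (x : X).
Hypothesis Kx : (K : set X) x.
Variables (C : set (continuum X)) (w : continuum X -> R).
Hypothesis CxK : forall A : continuum X, C A -> (A : set X) x /\ A `<=` K.
Hypothesis totC :
  forall A B : continuum X, C A -> C B -> A `<=` B \/ B `<=` A.
Hypothesis maxC : forall D : continuum X, (D : set X) x -> D `<=` K ->
  (forall A : continuum X, C A -> A `<=` D \/ D `<=` A) -> C D.
Hypothesis cw : continuous w.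
Hypothesis w_lt : forall A B : continuum X, A `<=` B -> A <> B -> w A < w B.

Let pt := singleton_continuum x.
Let a := w pt.
Let b := w K.

Let C_pt : C pt.
Proof.
apply: maxC => //; first by move=> _ ->.
by move=> A /CxK[Ax _]; right => _ ->.
Qed.

Let C_K : C K.
Proof. by apply: maxC => // A /CxK[_]; left. Qed.

Let sub_w (A B : continuum X) : A `<=` B -> w A <= w B.
Proof. by have [->//|/eqP AB /w_lt/(_ AB)/ltW] := eqVneq A B. Qed.

(** In the chain, the opposite inclusion would be strict and would reverse the inequality of
    values. *)
Let w_sub (A B : continuum X) : C A -> C B -> w A <= w B -> A `<=` B.
Proof.
move=> CA CB wAB; have [//|BA] := totC CA CB.
have [->//|/eqP BnA] := eqVneq B A.
by have := w_lt BA BnA; rewrite ltNge wAB.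
Qed.

Let w_inj (A B : continuum X) : C A -> C B -> w A = w B -> A = B.
Proof.
move=> CA CB wAB; apply: continuum_inj; apply/seteqP.
by split; apply: w_sub => //; rewrite wAB.
Qed.

(** The intersection is comparable with every member of [C], hence belongs to [C] by maximality. It
    is also the Vietoris limit of [S] directed downwards, so continuity of [w] carries lower bounds
    over to it. *)
Let C_inf (S : set (continuum X)) : S !=set0 -> S `<=` C ->
  exists I : continuum X, [/\ C I, I = \bigcap_(A in S) A :> set X &
    forall t, (forall A, S A -> t <= w A) -> t <= w I].
Proof.
move=> S0 SC; have totS A B (SA : S A) (SB : S B) := totC (SC _ SA) (SC _ SB).
have [I IE] := continuum_bigcap S0 totS; exists I; split => //.
- apply: maxC.
  + by rewrite IE => A /SC/CxK[].
  + have [A SA] := S0; rewrite IE => y /(_ _ SA); have [_] := CxK (SC _ SA).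
    exact.
  + move=> A CA.
    have [[B [SB BA]]|nBA] := pselect (exists B : continuum X, S B /\ B `<=` A).
      by right; rewrite IE => y /(_ _ SB) /BA.
    left; rewrite IE => y Ay B SB; have [AB|BA] := totC CA (SC _ SB).
      exact: AB.
    by case: nBA; exists B.
- move=> t St; pose F := filter_from S (fun A => [set B | S B /\ B `<=` A]).
  have FF : ProperFilter F.
    apply: filter_from_proper; last by move=> A SA; exists A; split.
    apply: filter_from_filter => // A B SA SB; have [AB|BA] := totS _ _ SA SB.
      by exists A => // D [SD DA]; split; split => //;
        exact: (subset_trans DA AB).
    by exists B => // D [SD DB]; split; split => //;
        exact: (subset_trans DB BA).
  have FI : F --> I.
    apply: cvg_vietoris => U oU; rewrite IE => IU.
      have [A SA AU] := chain_bigcap_sub_open S0 totS oU IU.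
      by exists A => // B [_ BA]; exact: (subset_trans BA AU).
    have [A SA] := S0; exists A => // B [SB _].
    by have [y [Iy Uy]] := IU; exists y; split => //; exact: Iy.
  apply: (continuous_limit_ge FF cw FI).
  by have [A SA] := S0; exists A => // B [SB _]; exact: St.
Qed.

(** Dual to [C_inf], with [S] directed upwards; the closure keeps the union compact and does not
    change which open sets it meets. *)
Let C_sup (S : set (continuum X)) : S !=set0 -> S `<=` C ->
  exists I : continuum X, [/\ C I, I = closure (\bigcup_(A in S) A) :> set X &
    forall t, (forall A, S A -> w A <= t) -> w I <= t].
Proof.
move=> S0 SC; have totS A B (SA : S A) (SB : S B) := totC (SC _ SA) (SC _ SB).
have [I IE] := continuum_closure_bigcup S0 (fun A SA => CxK (SC A SA)).
have SI (A : continuum X) : S A -> A `<=` I.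
  by move=> SA; rewrite IE => y Ay; apply: subset_closure; exists A.
have Iclosed (A : continuum X) :
    (forall B : continuum X, S B -> B `<=` A) -> I `<=` A.
  move=> SA; rewrite IE; have := @continuum_closed _ _ A.
  move=> /closure_id ->; apply: closureS => y [B SB]; exact: SA.
exists I; split => //.
- apply: maxC.
  + have [A SA] := S0; apply: (SI _ SA).
    by have [] := CxK (SC _ SA).
  + by apply: Iclosed => A /SC/CxK[].
  + move=> A CA.
    have [[B [SB AB]]|nAB] := pselect (exists B : continuum X, S B /\ A `<=` B).
      by left; apply: subset_trans (SI _ SB).
    right; apply: Iclosed => B SB; have [AB|//] := totC CA (SC _ SB).
    by case: nAB; exists B.
- move=> t St; pose F := filter_from S (fun A => [set B | S B /\ A `<=` B]).
  have FF : ProperFilter F.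
    apply: filter_from_proper; last by move=> A SA; exists A; split.
    apply: filter_from_filter => // A B SA SB; have [AB|BA] := totS _ _ SA SB.
      by exists B => // D [SD BD]; split; split => //;
        exact: (subset_trans AB BD).
    by exists A => // D [SD AD]; split; split => //;
        exact: (subset_trans BA AD).
  have FI : F --> I.
    apply: cvg_vietoris => U oU IU.
      have [A SA] := S0; exists A => // B [SB _].
      exact: (subset_trans (SI _ SB) IU).
    have [y []] := IU; rewrite IE => /(_ U) /[swap] Uy.
    case; first exact: open_nbhs_nbhs.
    move=> z [[A SA Az] Uz]; exists A => // B [SB AB].
    by exists z; split => //; exact: AB.
  apply: (continuous_limit_le FF cw FI).
  by have [A SA] := S0; exists A => // B [SB _]; exact: St.
Qed.

(** Let [A] be the supremum of the members of value at most [t], and [B] the infimum of those of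
    value at least [t]. If they differed, a continuum [D] strictly between them would belong to the
    chain by maximality, and its value would force it into [A] or around [B]. *)
Let w_surj t : a <= t <= b -> exists A, C A /\ w A = t.
Proof.
move=> /andP[at_ tb].
have [||A [CA AE wA]] := @C_sup [set A | C A /\ w A <= t].
- by exists pt.
- by move=> ? [].
have [||B [CB BE wB]] := @C_inf [set A | C A /\ t <= w A].
- by exists K.
- by move=> ? [].
have {}wA : w A <= t by apply: wA => D [].
have {}wB : t <= w B by apply: wB => D [].
have AB : A `<=` B by apply: w_sub => //; exact: le_trans wB.
have [AeqB|/eqP AnB] := eqVneq A B.
  by exists A; split => //; apply/eqP; rewrite eq_le wA AeqB.
have [D [AD DB DA DnB]] := continuum_between AB AnB.
have CD : C D.
  apply: maxC; first by apply: AD; have [] := CxK CA.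
    by apply: subset_trans DB _; have [] := CxK CB.
  move=> E CE; have [wE|/ltW wE] := leP (w E) t.
    left; apply: subset_trans AD; rewrite AE => y Ey.
    by apply: subset_closure; exists E.
  by right; apply: subset_trans DB _; rewrite BE => y /(_ E); exact.
have [wD|/ltW wD] := leP (w D) t.
  case: DA; apply: continuum_inj; apply/seteqP; split => //.
  by rewrite AE => y Dy; apply: subset_closure; exists D.
case: DnB; apply: continuum_inj; apply/seteqP; split => //.
by rewrite BE => y /(_ D); exact.
Qed.

(** The inverse of [w] on the chain. The default [pt] is itself a member, so [Ch] holds for every
    [t], also outside the interval. *)
Let h t := xget pt [set A | C A /\ w A = t].

Let Ch t : C (h t).
Proof. by rewrite /h; case: xgetP => // A _ []. Qed.

Let wh t : a <= t <= b -> w (h t) = t.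
Proof.
move=> /w_surj[A At]; rewrite /h; case: xgetP => [B _ []//|noA].
by case: (noA A).
Qed.

(** For [t] below [b], [h t] is the intersection of the members of value above [t], so one of them
    lies in any open [U] around [h t]. For [t] above [a], it is the closure of the union of the
    members of value below [t], so one of them meets any open [U] that [h t] meets. At the ends,
    monotonicity suffices. *)
Let ch : {within `[a, b], continuous h}.
Proof.
apply/subspace_continuousP => t; rewrite /= in_itv/= => tab.
have /andP[at_ tb] := tab.
have W (B : set R) (Q : set (continuum X)) : open B -> B t ->
    (forall s, a <= s <= b -> B s -> Q (h s)) ->
    (h @ within `[a, b] (nbhs t)) Q.
  move=> oB Bt BQ; have : nbhs (t : R) B by exact: open_nbhs_nbhs.
  apply: (@filterS _ _ (nbhs_filter (t : R))) => s Bs /=.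
  by rewrite in_itv/= => sab; exact: BQ.
apply: cvg_vietoris => U oU hU.
  have [bt|tb'] := leP b t.
    apply: (W setT) => // [|s sab _ /=]; first exact: openT.
    apply: subset_trans hU; apply: w_sub => //; rewrite !wh//.
    by case/andP: sab => _ sb; exact: le_trans bt.
  have [||I [CI IE wI]] := @C_inf [set A | C A /\ t < w A].
  - by exists K.
  - by move=> ? [].
  have {}wI : t <= w I by apply: wI => A [_ /ltW].
  (* Otherwise a member of value halfway between [t] and [w I] is one of the sets intersected; it
     contains [I] and yet has a smaller value. *)
  have It : w I = t.
    apply/eqP; rewrite eq_le wI andbT leNgt; apply/negP => tI.
    have [_ IK] := CxK CI.
    have [|A [CA wA]] := @w_surj ((t + w I) / 2).
      by have wIK : w I <= b := sub_w IK; apply/andP; split; lra.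
    have IA : I `<=` A by rewrite IE => y; apply; split => //; lra.
    have := sub_w IA; lra.
  have {}IE : h t = \bigcap_(A in [set A | C A /\ t < w A]) A :> set X.
    by rewrite -IE (w_inj (Ch t) CI)// It wh.
  have [||||A [CA tA] AU] :=
    @chain_bigcap_sub_open _ _ [set A | C A /\ t < w A] U.
  - by exists K.
  - by move=> A B [CA _] [CB _]; exact: totC.
  - by [].
  - by rewrite -IE.
  apply: (W [set s | s < w A]) => [|//|s sab sA /=]; first exact: open_lt.
  apply: subset_trans AU; apply: w_sub => //; rewrite wh//.
  exact: ltW.
have [ta|at'] := leP t a.
  apply: (W setT) => // [|s sab _ /=]; first exact: openT.
  have [y [hy Uy]] := hU; exists y; split => //.
  apply: (w_sub (Ch t) (Ch s)) hy; rewrite !wh//.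
  by case/andP: sab => + _; exact: le_trans ta.
have [||I [CI IE wI]] := @C_sup [set A | C A /\ w A < t].
- by exists pt.
- by move=> ? [].
have {}wI : w I <= t by apply: wI => A [_ /ltW].
have It : w I = t.
  apply/eqP; rewrite eq_le wI/= leNgt; apply/negP => tI.
  have ptI : pt `<=` I by have [] := CxK CI; move=> Ix _ _ ->.
  have [|A [CA wA]] := @w_surj ((t + w I) / 2).
    by have wI' : a <= w I := sub_w ptI; apply/andP; split; lra.
  have AI : A `<=` I.
    rewrite IE => y Ay; apply: subset_closure.
    by exists A => //; split => //; lra.
  have := sub_w AI; lra.
have {}IE : h t = closure (\bigcup_(A in [set A | C A /\ w A < t]) A) :> set X.
  by rewrite -IE (w_inj (Ch t) CI)// It wh.
have [y [hy Uy]] := hU; move: hy.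
rewrite IE => /(_ U (open_nbhs_nbhs (conj oU Uy)))[z [[A [CA At] Az] Uz]].
apply: (W [set s | w A < s]) => [|//|s sab As /=]; first exact: open_gt.
exists z; split => //; apply: (w_sub CA (Ch s)) Az; rewrite wh//.
exact: ltW.
Qed.

Lemma order_arc_of_chain : exists (a b : R) (h : R -> continuum X),
  [/\ a <= b, {within `[a, b], continuous h}, {in `[a, b] &, injective h},
      h a = pt & h b = K] /\ forall t, h t `<=` K.
Proof.
have ab : a <= b by apply: sub_w => _ ->.
exists a, b, h; split; last by move=> t; have [] := CxK (Ch t).
split => //.
- by move=> s t; rewrite !in_itv/= => sab tab hst; rewrite -(wh sab) hst wh.
- by apply: w_inj => //; rewrite wh// lexx.
- by apply: w_inj => //; rewrite wh// lexx andbT.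
Qed.

End order_arc.

Lemma order_arc (R : realType) (X : metricType R) (K : continuum X) (x : X) :
  separable X -> (K : set X) x ->
  exists (a b : R) (h : R -> continuum X),
  [/\ a <= b, {within `[a, b], continuous h}, {in `[a, b] &, injective h},
      h a = singleton_continuum x & h b = K] /\ forall t, h t `<=` K.
Proof.
move=> sX Kx; have [w cw w_lt] := whitney_map sX.
have [C [CxK totC maxC]] :=
  maximal_chain [set A : continuum X | (A : set X) x /\ A `<=` K].
by apply: (order_arc_of_chain Kx CxK totC _ cw w_lt) => D Dx DK; exact: maxC.
Qed.

(** * Injective paths and arcs *)

(* The case [a = b] is allowed, so that the relation is reflexive and that
   concatenation needs no case distinction. *)
Definition arc_path (R : realType) (Z : topologicalType) (x y : Z) : Prop :=
  exists (a b : R) (g : R -> Z),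
    [/\ a <= b, {within `[a, b], continuous g}, {in `[a, b] &, injective g},
        g a = x & g b = y].

Lemma within_continuous_reparam (R : realType) (Z : topologicalType)
    (A B : set R) (phi : R -> R) (g : R -> Z) :
  continuous phi -> (forall t, B t -> A (phi t)) ->
  {within A, continuous g} -> {within B, continuous (g \o phi)}.
Proof.
move=> cphi BA /subspace_continuousP cg; apply/subspace_continuousP => t Bt.
apply: (@cvg_comp _ _ _ phi g _ (within A (nbhs (phi t)))).
  move=> W phiW; have := cphi t _ phiW.
  by apply: (@filterS _ _ (nbhs_filter t)) => s /= sW Bs; apply: sW; exact: BA.
exact: cg (BA _ Bt).
Qed.

Lemma arc_path_refl (R : realType) (Z : topologicalType) (x : Z) :
  arc_path R x x.
Proof.
exists 0, 0, (fun=> x); split => //.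
  by apply: continuous_subspaceT => ?; exact: cvg_cst.
by move=> s t; rewrite !in_itv/= => s0 t0 _; apply/eqP; rewrite eq_le; lra.
Qed.

Lemma arc_path_sym (R : realType) (Z : topologicalType) (x y : Z) :
  arc_path R x y -> arc_path R y x.
Proof.
move=> [a [b [g [ab cg ig gx gy]]]]; exists (- b), (- a), (g \o -%R).
split; rewrite /= ?opprK ?lerN2//.
  apply: (within_continuous_reparam _ _ cg); first exact: opp_continuous.
  by move=> t; rewrite /= !in_itv/=; lra.
move=> s t; rewrite !in_itv/= => sab tab /ig; rewrite !in_itv/= => E.
by apply: oppr_inj; apply: E; lra.
Qed.

(** Since [Z] is Hausdorff, the image of [k] is closed, so there is a first time [t0] at which [g]
    meets it, say at [k s0]. The new path follows [g] up to [t0] and then [k] from [s0]. *)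
Lemma arc_path_trans (R : realType) (Z : topologicalType) (x y z : Z) :
  hausdorff_space Z -> arc_path R x y -> arc_path R y z -> arc_path R x z.
Proof.
move=> hZ [a [b [g [ab cg ig gx gy]]]] [c [d [k [cd ck ik ky kz]]]].
pose S := [set t | g t \in (k @` `[c, d])] `&` `[a, b].
have clk : closed (k @` `[c, d]).
  apply: compact_closed => //; apply: continuous_compact ck _.
  exact: segment_compact.
have cS : compact S.
  apply: (@subclosed_compact _ _ `[a, b]); last 2 first.
  - exact: segment_compact.
  - by move=> t [].
  rewrite /S closed_setIS; last exact: interval_closed.
  have := (@continuous_closedP _ _ (from_subspace `[a, b] g)).1 cg _ clk.
  by congr closed; apply/seteqP; split => t; rewrite /= inE.
have S0 : S !=set0.
  exists b; split; last by rewrite /= in_itv/= ab lexx.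
  by rewrite /= inE; exists c; rewrite ?ky//= in_itv/= cd lexx.
have [t0] := compact_EVT_min S0 cS
  (continuous_subspaceT (fun t => @cvg_id _ (nbhs t))).
rewrite inE => -[] /=; rewrite inE => -[s0] /= s0cd ks0 t0ab mint0.
have {}mint0 t : `[a, b]%classic t -> (k @` `[c, d]) (g t) -> t0 <= t.
  by move=> tab gt; apply: mint0; rewrite inE; split; rewrite //= inE.
rewrite !in_itv/= in s0cd t0ab.
(* The second path is shifted in time so that [s0] falls on [t0]; [e] is the shifted end time. *)
pose e := t0 + (d - s0).
pose p t := if t <= t0 then g t else k (t - t0 + s0).
have pk t : t0 <= t -> p t = k (t - t0 + s0).
  rewrite /p le_eqVlt => /predU1P[<-|]; first by rewrite lexx subrr add0r ks0.
  by rewrite ltNge => /negbTE ->.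
have pg t : t <= t0 -> p t = g t by rewrite /p => ->.
(* A common point of the two pieces occurs no earlier than [t0] on the first one, by minimality,
   hence exactly at [t0]; injectivity of [k] then fixes the time on the second. *)
have cross s t : a <= s -> s <= t0 -> t0 <= t -> t <= e -> p s = p t -> s = t.
  move=> as_ st0 t0t te; rewrite (pg _ st0) (pk _ t0t) => gk.
  have /mint0 t0s : `[a, b]%classic s by rewrite /= in_itv/=; lra.
  have {}t0s : t0 <= s.
    apply: t0s; exists (t - t0 + s0) => //=; rewrite in_itv/=.
    by rewrite /e in te; lra.
  have st : s = t0 by lra.
  move: gk; rewrite st -ks0 => /ik; rewrite !in_itv/= => E.
  rewrite /e in te; have : s0 = t - t0 + s0 by apply: E; lra.
  by lra.
exists a, e, p; split.
- by rewrite /e; lra.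
- have -> : `[a, e]%classic = `[a, t0] `|` `[t0, e].
    apply/seteqP; split => t; rewrite /= !in_itv/=.
      move=> ate; have [tt|tt] := leP t t0; [left|right]; lra.
    by rewrite /e; case=> ?; lra.
  apply: withinU_continuous; [exact: interval_closed|exact: interval_closed| |].
    apply: (@subspace_eq_continuous _ _ _ g).
      move=> t; rewrite inE/= in_itv/= => tt.
      by rewrite /from_subspace pg//; lra.
    apply: continuous_subspaceW cg => t; rewrite /= !in_itv/=; lra.
  apply: (@subspace_eq_continuous _ _ _ (k \o (fun t => t - t0 + s0))).
    move=> t; rewrite inE/= in_itv/= => tt.
    by rewrite /from_subspace pk//; lra.
  apply: (within_continuous_reparam _ _ ck).
    move=> t; apply: cvgD; last exact: cvg_cst.
    by apply: cvgB; [exact: cvg_id|exact: cvg_cst].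
  by move=> t; rewrite /= !in_itv/= /e; lra.
- move=> s t; rewrite !in_itv/= => sae tae.
  have [st0|/ltW st0] := leP s t0; have [tt0|/ltW tt0] := leP t t0.
  + by rewrite !pg// => /ig; rewrite !in_itv/=; apply; lra.
  + by apply: cross; lra.
  + by move=> pst; apply/esym; apply: cross; rewrite //; lra.
  + rewrite !pk// => /ik; rewrite !in_itv/= => E.
    rewrite /e in sae tae; have : s - t0 + s0 = t - t0 + s0 by apply: E; lra.
    by lra.
- by rewrite pg//; lra.
- rewrite pk; last by rewrite /e; lra.
  by rewrite /e -kz; congr k; lra.
Qed.

Lemma continuous_to_set_type (S T : topologicalType) (A : set T)
    (f : S -> set_type A) : continuous (set_val \o f) -> continuous f.
Proof. exact: continuous_comp_initial. Qed.

(** A continuous injection of a compact interval into a Hausdorff space is an embedding. A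
    degenerate interval falls under the equality case of [arc_rel]. *)
Lemma arc_path_arc_rel (R : realType) (Z : topologicalType) (x y : Z) :
  hausdorff_space Z -> arc_path R x y -> arc_rel R x y.
Proof.
move=> hZ [a [b [g [ab cg ig gx gy]]]].
have [abE|/eqP a_neq_b] := eqVneq a b; first by left; rewrite -gx -gy abE.
have {}ab : a < b by rewrite lt_neqAle ab andbT; exact/eqP.
have ba : 0 < b - a by rewrite subr_gt0.
right.
pose I := `[0 : R, 1]%classic.
pose phi (t : R) := t * (b - a) + a.
have phiI t : I t -> `[a, b]%classic (phi t).
  rewrite /I /phi /= !in_itv/= => /andP[t0 t1].
  have := mulr_ge0 t0 (ltW ba); have : t * (b - a) <= b - a.
    by rewrite ler_piMl// ltW.
  by lra.
have phi_inj : injective phi.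
  by move=> s t /addIr/mulIf; apply; rewrite gt_eqF.
have cphi : continuous phi.
  move=> t; apply: cvgD; last exact: cvg_cst.
  by apply: cvgM; [exact: cvg_id|exact: cvg_cst].
pose l := g \o phi.
have cl : {within I, continuous l} by exact: within_continuous_reparam cg.
have il : {in I &, injective l}.
  move=> s t; rewrite !inE => Is It lst; apply: phi_inj; apply: ig => //.
  - exact: phiI.
  - exact: phiI.
have lI (u : I) : l (set_val u) \in l @` I.
  by rewrite inE; exists (set_val u) => //; exact: set_valP.
pose f (u : I) : set_type (l @` I) := exist (fun z => z \in l @` I) _ (lI u).
have gP (v : set_type (l @` I)) : exists u : I, f u = v.
  case: v => v vI; have := vI; rewrite inE => -[t It ltv].
  exists (exist (fun t => t \in I) t (mem_set It)).
  by apply: val_inj => /=.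
pose k v := projT1 (cid (gP v)).
have kK : cancel k f by move=> v; rewrite /k; case: cid.
have f_inj : injective f.
  move=> u v /(congr1 (set_val))/= luv; apply: val_inj.
  by apply: il => //; rewrite inE; exact: set_valP.
exists (l @` I); split.
- exists f, k; split.
  + by apply: continuous_to_set_type; exact/subspace_sigL_continuousP.
  (* Continuity of the inverse: the points of [I] outside [W] form a compact set, and its image is
     closed. *)
  + apply/continuousP => _ [W oW <-].
    exists (~` (l @` (I `&` ~` W))).
      apply: closed_openC; apply: compact_closed => //.
      apply: continuous_compact.
        by apply: continuous_subspaceW cl => t [].
      apply: compact_closedI; [exact: segment_compact|exact: open_closedC].
    apply/seteqP; split => v /=.
      move=> nv; apply: contrapT => nW; apply: nv.
      exists (set_val (k v)); first by split => //; exact: set_valP.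
      by rewrite -[in RHS](kK v).
    move=> Wv [t [It nWt] ltv]; apply: nWt.
    suff -> : t = set_val (k v) by [].
    apply: il; rewrite ?inE//; first exact: set_valP.
    by rewrite ltv -[in LHS](kK v).
  + by move=> u; apply: f_inj; rewrite kK.
  + exact: kK.
- exists 0; first by rewrite /I /= in_itv/= lexx ler01.
  by rewrite /l /phi /= mul0r add0r.
- exists 1; first by rewrite /I /= in_itv/= lexx ler01.
  by rewrite /l /phi /= mul1r subrK.
Qed.

(** The parametrisation of the arc is restricted to the interval between the parameters of [x] and
    [y], and reversed if these come in the wrong order. *)
Lemma arc_rel_arc_path (R : realType) (Z : topologicalType) (x y : Z) :
  arc_rel R x y -> arc_path R x y.
Proof.
case=> [->|[A [[f [k [cf ck fK kK]]] Ax Ay]]]; first exact: arc_path_refl.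
pose I := `[0 : R, 1]%classic.
have I0 : 0 \in I by rewrite inE /I /= in_itv/= lexx ler01.
(* Outside [I] this takes the value of [f] at 0; only its restriction to [I] matters. *)
pose g t := set_val (f (insubd (exist (fun t => t \in I) 0 I0) t)).
have cg : {within I, continuous g}.
  apply/subspace_sigL_continuousP.
  have -> : sigL I g = set_val \o f.
    by apply/funext => u; rewrite /sigL /g /= valKd.
  by move=> u; apply: continuous_comp; [exact: cf|exact: initial_continuous].
have ig : {in I &, injective g}.
  move=> s t Is It /val_inj/(can_inj fK)/(congr1 val).
  by rewrite !val_insubd Is It.
have gP z : A z -> exists2 t, I t & g t = z.
  move=> Az; exists (set_val (k (exist (fun z => z \in A) z (mem_set Az)))).
    exact: set_valP.
  by rewrite /g valKd kK.
suff wl s t u v : s <= t -> I s -> I t -> g s = u -> g t = v -> arc_path R u v.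
  have [[s Is gs] [t It gt]] := (gP _ Ax, gP _ Ay).
  have [st|/ltW ts] := leP s t; first exact: (wl s t).
  by apply: arc_path_sym; exact: (wl t s).
move=> st Is It gs gt; exists s, t, g.
have sub r : `[s, t]%classic r -> I r.
  by move: Is It; rewrite /I /= !in_itv/=; lra.
split => //; first by apply: continuous_subspaceW cg.
move=> r q rst qst; apply: ig; rewrite inE; exact: sub.
Qed.

Lemma arc_relP (R : realType) (Z : topologicalType) (x y : Z) :
  hausdorff_space Z -> arc_rel R x y <-> arc_path R x y.
Proof.
move=> hZ; split; [exact: arc_rel_arc_path|exact: arc_path_arc_rel].
Qed.

(** * Separation in the hyperspace, and unions of families of continua *)

(** If [x] lies in [K] but not in [L], the continua that meet a small ball about [x] and those that
    stay outside a slightly larger one form disjoint neighbourhoods of [K] and [L]. *)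
Lemma continuum_hausdorff (R : realType) (X : metricType R) :
  hausdorff_space (continuum X).
Proof.
suff sub (K L : continuum X) : cluster (nbhs K) L -> K `<=` L.
  move=> K L KL; apply: continuum_inj; apply/seteqP; split; apply: sub => //.
  by move=> A B LA KB; rewrite setIC; exact: KL.
move=> KL x Kx; apply: contrapT => nLx.
have : nbhs x (~` (L : set X)).
  by apply: open_nbhs_nbhs; split => //; exact/closed_openC/continuum_closed.
move=> /nbhs_ballP[r /= r0 xrL].
pose f := mdist x : X -> R.
pose U := f @^-1` [set t | t < r / 2].
pose V := f @^-1` [set t | r / 2 < t].
have oU : open U.
  by apply: open_comp => [? _|]; [exact: mdist_continuous|exact: open_lt].
have oV : open V.
  by apply: open_comp => [? _|]; [exact: mdist_continuous|exact: open_gt].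
have [||M [[y [My yU]] MV]] :=
    KL [set M : continuum X | M `&` U !=set0] [set M : continuum X | M `<=` V].
- apply: open_nbhs_nbhs; split; first exact: open_vietoris_meet.
  by exists x; split => //; rewrite /U /f/= mdistxx divr_gt0.
- apply: open_nbhs_nbhs; split; first exact: open_vietoris_sub.
  move=> z Lz; rewrite /V /f/= ltNge; apply/negP => zr; apply: (xrL z) => //.
  by rewrite ballEmdist/= (le_lt_trans zr)// gtr_pMr// invf_lt1// ltr1n.
- by have := MV _ My; move: yU; rewrite /U /V /=; lra.
Qed.

Lemma hausdorff_set_type (T : topologicalType) (A : set T) :
  hausdorff_space T -> hausdorff_space (set_type A).
Proof.
move=> hT p q pq; apply: val_inj; apply: hT => B C pB qC.
have [||r [Br Cr]] := pq (set_val @^-1` B) (set_val @^-1` C).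
- exact: (@initial_continuous _ _ (set_val : A -> T) p).
- exact: (@initial_continuous _ _ (set_val : A -> T) q).
- by exists (set_val r).
Qed.

(** Compactness is used twice: in each [K] to cover a whole neighbourhood of [K], hence all continua
    Vietoris-close to it, and then in [S]. *)
Lemma compact_bigcup_continua (R : realType) (X : metricType R)
    (S : set (continuum X)) :
  compact S -> compact (\bigcup_(K in S) (K : set X)).
Proof.
move=> /compact_near_coveringP cS; apply/compact_near_coveringP => I F P FF cov.
have : \near F, S `<=` (fun L : continuum X => L `<=` P F).
  apply: cS => K SK.
  (* The radius is a further parameter tending to 0, so that one radius serves all points of [K],
     like a Lebesgue number. *)
  have /compact_near_coveringP/(_ (R * I)%type
    (filter_prod (0 : R)^'+ F) (fun p x => ball x p.1 `<=` P p.2) _) :=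
    @continuum_compact _ K.
  case.
    move=> x Kx.
    have [] : \forall x' \near x & i \near F, P i x' by apply: cov; exists K.
    case=> /= A B [/nbhs_ballP[r /= r0 xrA] FB] ABP.
    exists (ball x (r / 2), [set d | d < r / 2] `*` B).
      split => /=; first by apply: nbhsx_ballx; rewrite divr_gt0.
      exists ([set d | d < r / 2], B) => //; split => //=.
      by apply: nbhs_right_lt; rewrite divr_gt0.
    move=> [x' [d i]] /= [xx' [dr Bi]] z x'z; apply: (ABP (z, i)); split => //=.
    apply: xrA; have := ball_triangle xx' (le_ball (ltW dr) x'z).
    by rewrite -splitr.
  move=> [A B] /= [A0 FB] ABP.
  have [d [Ad d0]] : exists d, A d /\ 0 < d.
    near (0 : R)^'+ => d; exists d; split; first by near: d.
    by near: d; exact: nbhs_right_gt.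
  pose U := \bigcup_(x in K : set X) (ball x d)°.
  exists ([set L : continuum X | L `<=` U], B).
    split => //=; apply: open_nbhs_nbhs; split.
      apply: open_vietoris_sub; apply: bigcup_open => x _.
      exact: open_interior.
    by move=> x Kx; exists x => //; exact: nbhsx_ballx.
  move=> [L i] /= [LU Bi] z /LU[x Kx /interior_subset xz].
  exact: (ABP (d, i)) xz.
by apply: filterS => i Si x [K SK]; exact: Si.
Unshelve. all: by end_near. Qed.

(** Each member lies inside a relatively clopen subset [B] of the union or misses it. The members
    inside form a relatively clopen subset of [S], which is all of [S] by connectedness. *)
Lemma connected_bigcup_continua (T : topologicalType) (S : set (continuum T)) :
  connected S -> connected (\bigcup_(K in S) (K : set T)).
Proof.
move=> cS B [y By] [U oU BU] [V cV BV].
have KUV (K : continuum T) : S K -> K `&` U = K `&` V.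
  move=> SK; apply/seteqP; split => x [Kx].
    move=> Ux; split => //; have : B x by rewrite BU; split => //; exists K.
    by rewrite BV => -[].
  move=> Vx; split => //; have : B x by rewrite BV; split => //; exists K.
  by rewrite BU => -[].
have KU (K : continuum T) : S K -> K `&` U !=set0 -> K `<=` U.
  move=> SK KU0; suff <- : K `&` U = K by exact: subIsetr.
  apply: (@continuum_connected _ K) => //; first by exists U.
  by exists V => //; rewrite KUV.
have SU : S `&` [set K : continuum T | K `<=` U] = S.
  apply: cS.
  - move: By; rewrite BU => -[[K SK Ky] Uy]; exists K; split => //=.
    by apply: KU => //; exists y.
  - by exists [set K : continuum T | K `<=` U] => //; exact: open_vietoris_sub.
  - exists (~` [set K : continuum T | K `<=` ~` V]).
      by apply: open_closedC; apply: open_vietoris_sub; exact: closed_openC.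
    apply/seteqP; split => K [SK].
      move=> /= sKU; split => // KnV; have [x Kx] := continuum_nonempty K.
      have : (K `&` V) x by rewrite -KUV//; split => //; exact: sKU.
      by case=> _; exact: KnV.
    move=> /= nKV; split => //=; apply: KU => //.
    apply: contrapT => /nonemptyPn KU0; apply: nKV => x Kx Vx.
    by have : set0 x by rewrite -KU0 KUV.
rewrite BU; apply/setIidPl => x [K SK Kx].
by move: SK Kx; rewrite -SU => -[_]; exact.
Qed.

(** * Small continua, chains, and the passage from paths to chains *)

Section small.
Context {R : realType} {X : metricType R}.
Variable eps : R.

Lemma diam_le (A : set X) (d : R) :
  (forall x y, A x -> A y -> mdist x y <= d) -> (diam A <= d%:E)%E.
Proof.
move=> Ad; apply: ge_ereal_sup => _ [[x y] [Ax Ay] <-].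
by rewrite lee_fin; exact: Ad.
Qed.

Lemma mdist_diam (A : set X) x y : A x -> A y -> ((mdist x y)%:E <= diam A)%E.
Proof. by move=> Ax Ay; apply: ereal_sup_ubound; exists (x, y). Qed.

Lemma small_sub (K L : continuum X) :
  K `<=` L -> small_continua eps L -> small_continua eps K.
Proof.
move=> KL; apply: le_lt_trans; apply: ereal_sup_le => _ [[x y] [Kx Ky] <-].
by exists (x, y) => //; split; exact: KL.
Qed.

Lemma small_nbhs (K : continuum X) : small_continua eps K ->
  exists U, [/\ open U, K `<=` U &
    forall L : continuum X, L `<=` U -> small_continua eps L].
Proof.
rewrite /small_continua/= => Keps.
have [x Kx] := continuum_nonempty K.
have := mdist_diam Kx Kx; rewrite mdistxx.
(* The diameter is finite: the bound by [eps] excludes [+oo], and the point [x] excludes [-oo]. *)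
case dK : (diam K) Keps => [d| |]//=; rewrite lte_fin lee_fin => de d0.
(* Enlarging [K] by [r] raises the diameter by at most [2 * r], half of the room below [eps]. *)
pose r := (eps - d) / 4.
have r0 : 0 < r by rewrite divr_gt0// subr_gt0.
exists (\bigcup_(x in K : set X) (ball x r)°); split.
- by apply: bigcup_open => ? _; exact: open_interior.
- by move=> y Ky; exists y => //; exact: nbhsx_ballx.
- move=> L LU; apply: (@le_lt_trans _ _ (d + 2 * r)%:E).
    apply: diam_le => y z /LU[y' Ky' /interior_subset yy'].
    move=> /LU[z' Kz' /interior_subset zz'].
    move: yy' zz'; rewrite !ballEmdist/= => yy' zz'.
    have : mdist y' z' <= d by have := mdist_diam Ky' Kz'; rewrite dK lee_fin.
    have := metric_triangle y y' z; have := metric_triangle y' z' z.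
    rewrite (metric_sym y y'); lra.
  by rewrite lte_fin /r; lra.
Qed.

Lemma chain_rel_link (K : continuum X) (x y : X) :
  small_continua eps K -> (K : set X) x -> (K : set X) y -> chain_rel eps x y.
Proof. by move=> sK Kx Ky; exists 0%N, (fun=> K); split. Qed.

Lemma chain_rel_trans (x y z : X) :
  chain_rel eps x y -> chain_rel eps y z -> chain_rel eps x z.
Proof.
move=> [k [K [sK Kx Ky KK]]] [l [L [sL Ly Lz LL]]].
(* The second chain starts at index [k.+1]; the links at [k] and [k.+1] share [y]. *)
exists (k + l.+1)%N, (fun i => if (i <= k)%N then K i else L (i - k.+1)%N).
split => //.
- move=> i ikl; case: ifPn => [|ki]; first exact: sK.
  by apply: sL; rewrite -ltnNge in ki; lia.
- by rewrite addnS ltnNge leq_addr/= subSS addKn.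
- move=> i ikl; have [ik|ki|->] := ltngtP i k.
  + exact: KK.
  + have -> : (i.+1 - k.+1 = (i - k.+1).+1)%N by lia.
    by apply: LL; lia.
  + by exists y; rewrite ?subnn.
Qed.

(** A single link is enough: the union of the continua at times between [s] and [s'] stays in the
    open set of [small_nbhs] around the continuum at time [t]. *)
Lemma arc_path_chain_rel_loc (g : R -> set_type (@small_continua R X eps))
    (a b t : R) : {within `[a, b], continuous g} -> `[a, b]%classic t ->
  exists2 d : R, 0 < d & forall s s' (x y : X),
    `[a, b]%classic s -> `[a, b]%classic s' -> `|t - s| < d -> `|t - s'| < d ->
    (set_val (g s) : set X) x -> (set_val (g s') : set X) y ->
    chain_rel eps x y.
Proof.
move=> cg tab.
pose G := set_val \o g.
have cG : {within `[a, b], continuous G}.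
  move=> s; apply: (@continuous_comp (subspace `[a, b])); first exact: cg.
  exact: initial_continuous.
have [U [oU GU Usmall]] := small_nbhs (set_valP (g t)).
have : nbhs (G t) [set L : continuum X | L `<=` U].
  by apply: open_nbhs_nbhs; split => //; exact: open_vietoris_sub.
move=> /(((@subspace_continuousP _ _ _ G).1 cG) _ tab).
move=> /nbhs_ballP[d /= d0 dU].
have {}dU s : `[a, b]%classic s -> `|t - s| < d -> G s `<=` U.
  by move=> sab ts; apply: dU.
have main s s' x y : s <= s' -> `[a, b]%classic s -> `[a, b]%classic s' ->
    `|t - s| < d -> `|t - s'| < d ->
    (G s : set X) x -> (G s' : set X) y ->
    exists K : continuum X,
      [/\ small_continua eps K, (K : set X) x & (K : set X) y].
  move=> ss' sab s'ab ts ts' Gx Gy.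
  pose S := G @` `[s, s'].
  have sub r : `[s, s']%classic r -> `[a, b]%classic r /\ `|t - r| < d.
    move: sab s'ab ts ts'; rewrite /= !in_itv/= !ltr_norml => *; split; lra.
  have cGs : {within `[s, s'], continuous G}.
    by apply: continuous_subspaceW cG => r /sub[].
  have Sx : (\bigcup_(K in S) (K : set X)) x.
    by exists (G s) => //; exists s => //; rewrite /= in_itv/= lexx.
  have Sy : (\bigcup_(K in S) (K : set X)) y.
    by exists (G s') => //; exists s' => //; rewrite /= in_itv/= lexx andbT.
  have cptS : compact (\bigcup_(K in S) (K : set X)).
    apply: compact_bigcup_continua; apply: continuous_compact cGs _.
    exact: segment_compact.
  have conS : connected (\bigcup_(K in S) (K : set X)).
    apply: connected_bigcup_continua; apply: connected_continuous_connected cGs.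
    exact: segment_connected.
  exists (Continuum (ex_intro _ x Sx) cptS conS); split => //.
  apply: Usmall => z /= [_ [r /sub[rab tr] <-]].
  exact: (dU _ rab tr).
exists d => // s s' x y sab s'ab ts ts' Gx Gy.
have [ss'|/ltW s's] := leP s s'.
  have [K [sK Kx Ky]] := main _ _ x y ss' sab s'ab ts ts' Gx Gy.
  exact: chain_rel_link Kx Ky.
have [K [sK Ky Kx]] := main _ _ y x s's s'ab sab ts' ts Gy Gx.
exact: chain_rel_link Kx Ky.
Qed.

(** Induction along the interval: let [S] be the set of times whose continua are entirely reachable
    by chains from [x]. The local lemma at the supremum of [S] shows that [S] contains [b]. *)
Lemma path_chain_rel (g : R -> set_type (@small_continua R X eps))
    (a b : R) (x y : X) : a <= b -> {within `[a, b], continuous g} ->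
  (set_val (g a) : set X) x -> (set_val (g b) : set X) y -> chain_rel eps x y.
Proof.
move=> ab cg gx gy.
pose S := [set t | `[a, b]%classic t /\
  forall z, (set_val (g t) : set X) z -> chain_rel eps x z].
have Sa : S a.
  split; first by rewrite /= in_itv/= lexx.
  by move=> z; exact: chain_rel_link (set_valP (g a)) gx.
have Sb t : S t -> t <= b by move=> [/=]; rewrite in_itv/= => /andP[].
have supS : has_sup S by split; [exists a|exists b].
pose c := sup S.
have ac : a <= c by apply: ub_le_sup => //; case: supS.
have cb : c <= b by apply: ge_sup => //; exists a.
have cab : `[a, b]%classic c by rewrite /= in_itv/= ac.
have [d d0 loc] := arc_path_chain_rel_loc cg cab.
have [s [sab sS] cs] := sup_adherent d0 supS.
have sc : s <= c by apply: ub_le_sup => //; case: supS.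
have Sc t : `[a, b]%classic t -> `|c - t| < d -> S t.
  move=> tab ct; split => // z gz.
  have [p gp] := continuum_nonempty (set_val (g s)).
  apply: (chain_rel_trans (sS _ gp)); apply: (loc s t p z) => //.
  by rewrite ltr_norml; rewrite -/c in cs; lra.
have bS : S b.
  have [cltb|bc] := ltP c b; last first.
    have -> : b = c by apply/eqP; rewrite eq_le bc cb.
    by apply: Sc => //; rewrite subrr normr0.
  have [bd|db] := ltP (b - c) d.
    apply: Sc; first by rewrite /= in_itv/= ab lexx.
    by rewrite ltr_norml; lra.
  (* When [b] is at distance at least [d] from [c], this would be a time in [S] beyond its
     supremum. *)
  have : S (c + d / 2).
    apply: Sc; first by rewrite /= in_itv/=; lra.
    by rewrite ltr_norml; lra.
  move=> /(ub_le_sup supS.2); rewrite -/c; lra.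
by case: bS => _; apply.
Qed.

End small.

(** * Borel maps and a Borel selector on the hyperspace *)

Lemma sigma_algebra_setC (T : Type) (G : set (set T)) (A : set T) :
  <<s G >> A -> <<s G >> (~` A).
Proof. by move=> GA; rewrite -setTD; exact: sigma_algebraCD. Qed.

Lemma sigma_algebra_setU (T : Type) (G : set (set T)) (A B : set T) :
  <<s G >> A -> <<s G >> B -> <<s G >> (A `|` B).
Proof.
move=> GA GB; rewrite -bigcup2E; apply: sigma_algebra_bigcup => -[|[|n]] //.
exact: sigma_algebra0.
Qed.

Lemma sigma_algebra_setI (T : Type) (G : set (set T)) (A B : set T) :
  <<s G >> A -> <<s G >> B -> <<s G >> (A `&` B).
Proof.
move=> GA GB; rewrite -[_ `&` _]setCK setCI.
apply: sigma_algebra_setC.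
by apply: sigma_algebra_setU; exact: sigma_algebra_setC.
Qed.

Lemma borel_map_open (S T : topologicalType) (f : S -> T) :
  (forall U, open U -> <<s @open S >> (f @^-1` U)) -> borel_map f.
Proof.
move=> fo.
suff : <<s @open T >> `<=` [set B | <<s @open S >> (f @^-1` B)] by apply.
apply: smallest_sub => //; split => /=.
- by rewrite preimage_set0; exact: sigma_algebra0.
- by move=> A fA; rewrite setTD preimage_setC; exact: sigma_algebra_setC.
- by move=> A fA; rewrite preimage_bigcup; exact: sigma_algebra_bigcup.
Qed.

Lemma continuous_borel_map (S T : topologicalType) (f : S -> T) :
  continuous f -> borel_map f.
Proof.
move=> /continuousP cf; apply: borel_map_open => U /cf.
exact: sub_sigma_algebra.
Qed.

(** Closed balls about a dense sequence with radii [1 / (j + 1)]. Closed sets are chosen so that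
    intersecting a compact set with them keeps it compact. *)
Lemma metric_closed_net (R : realType) (X : metricType R) (x0 : X) :
  separable X -> exists F : nat -> set X, (forall n, closed (F n)) /\
    forall U x, open U -> U x -> exists n, F n x /\ F n `<=` U.
Proof.
move=> sX; have [q qd] := separable_dense_seq x0 sX.
pose e (j : nat) : R := j.+1%:R^-1.
have e0 j : 0 < e j by rewrite invr_gt0.
pose B (p : nat * nat) := [set y | mdist (q p.1) y <= e p.2].
(* Numbers that code no pair give the ball of index [(0, 0)], which only repeats a member of the
   family. *)
exists (fun n => B (odflt (0, 0)%N (unpickle n))); split.
  move=> n; set p := odflt _ _.
  have -> : B p = mdist (q p.1) @^-1` [set t | t <= e p.2] by [].
  apply: preimage_closed => [? _|]; last exact: closed_le.
  exact: mdist_continuous.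
move=> U x oU Ux; have : nbhs x U by exact: open_nbhs_nbhs.
move=> /nbhs_ballP[r /= r0 xrU].
have [j ej] : exists j, e j + e j < r.
  have r2 : 0 < r / 2 by rewrite divr_gt0.
  have [j jr] := ltr_add_invr r2; exists j.
  by rewrite add0r in jr; rewrite [ltRHS]splitr ltrD.
have [i qi] := qd x (e j) (e0 j).
exists (pickle (i, j)); rewrite pickleK /=; split; first exact: ltW.
move=> y; rewrite /B/= => qy; apply: xrU; rewrite ballEmdist/=.
have := metric_triangle x (q i) y; rewrite (metric_sym x (q i)).
move: (e j) ej qi qy => ej; lra.
Qed.

Section selector.
Context {R : realType} {X : metricType R}.
Variable F : nat -> set X.
Hypothesis cF : forall n, closed (F n).
Hypothesis Fnet : forall U x, open U -> U x -> exists n, F n x /\ F n `<=` U.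

(* The selected point lies in every set of this decreasing sequence; it belongs
   to [F n] iff [refine K n] meets [F n]. *)
Fixpoint refine (K : continuum X) (n : nat) : set X :=
  if n is m.+1 then
    if pselect (refine K m `&` F m !=set0) then refine K m `&` F m
    else refine K m
  else K.

Let refine_nonempty K n : refine K n !=set0.
Proof. by elim: n => [|n IH] /=; [exact: continuum_nonempty|case: pselect]. Qed.

Let refine_compact K n : compact (refine K n).
Proof.
elim: n => [|n IH] /=; first exact: continuum_compact.
by case: pselect => ? //; exact: compact_closedI.
Qed.

Let refine_sub K n m : (n <= m)%N -> refine K m `<=` refine K n.
Proof.
elim: m => [|m IH]; first by rewrite leqn0 => /eqP ->.
rewrite leq_eqVlt => /predU1P[->//|nm].
apply: (subset_trans _ (IH nm)) => /=; case: pselect => ? //.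
exact: subIsetl.
Qed.

Let refine_bigcap K : exists x, forall n, refine K n x.
Proof.
apply: contrapT => nK.
have [|||||_ [n _ <-]] :=
    @directed_bigcap_sub_open _ (range (refine K)) set0 (@metric_hausdorff _ X).
- by exists (refine K 0), 0%N.
- move=> _ _ [n _ <-] [m _ <-]; exists (refine K (maxn n m)).
    by exists (maxn n m).
  by move=> x Kx; split; apply: refine_sub Kx; rewrite ?leq_maxl ?leq_maxr.
- by move=> _ [n _ <-]; exact: refine_compact.
- exact: open0.
- by move=> x Kx; apply: nK; exists x => n; apply: Kx; exists n.
- by have [x Kx] := refine_nonempty K n => /(_ x Kx).
Qed.

(** The induction needs all closed [C] at once, since on the Borel set [M] a refinement step
    replaces [C] by its intersection with [F n]. Initially, the continua missing [C] form an open
    set. *)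
Lemma borel_refine (n : nat) (C : set X) : closed C ->
  <<s @open (continuum X) >> [set K | refine K n `&` C !=set0].
Proof.
elim: n C => [|n IH] C cC.
  have -> : [set K : continuum X | refine K 0 `&` C !=set0] =
      ~` [set K : continuum X | K `<=` ~` C].
    apply/seteqP; split => K /=; first by move=> [x [Kx Cx]] /(_ x Kx).
    move=> nK; apply: contrapT => KC; apply: nK => x Kx Cx.
    by apply: KC; exists x.
  apply: sigma_algebra_setC; apply: sub_sigma_algebra; apply: open_vietoris_sub.
  exact: closed_openC.
pose M := [set K : continuum X | refine K n `&` F n !=set0].
have -> : [set K | refine K n.+1 `&` C !=set0] =
    (M `&` [set K | refine K n `&` (F n `&` C) !=set0]) `|`
    (~` M `&` [set K | refine K n `&` C !=set0]).
  apply/seteqP; split => K /=; case: pselect => KF.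
  - by rewrite -setIA; left.
  - by right.
  - by rewrite -setIA => -[[]|[]].
  - by case=> -[].
apply: sigma_algebra_setU; apply: sigma_algebra_setI.
- exact: IH.
- by apply: IH; exact: closedI.
- by apply: sigma_algebra_setC; exact: IH.
- exact: IH.
Qed.

(** Any point of the intersection of the refinements may be chosen: whether it lies in [F n] is
    decided by the Borel condition that [refine K n] meets [F n], and an open set is the union of
    the [F n] it contains. *)
Lemma borel_selector_of_net : exists2 f : continuum X -> X,
  borel_map f & forall K : continuum X, (K : set X) (f K).
Proof.
have /choice[f fP] := refine_bigcap.
exists f; last by move=> K; exact: (fP K 0%N).
have fF n K : F n (f K) <-> refine K n `&` F n !=set0.
  split=> [FK|KF]; first by exists (f K); split => //; exact: fP.
  by have := fP K n.+1; rewrite /=; case: pselect => // ? [].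
apply: borel_map_open => U oU.
have -> : f @^-1` U = \bigcup_n (if pselect (F n `<=` U) then
    [set K | refine K n `&` F n !=set0] else set0).
  apply/seteqP; split => K /=.
    move=> /(Fnet oU)[n [FK FU]]; exists n => //.
    by case: pselect => ? //; exact/fF.
  by move=> [n _]; case: pselect => // FU /fF; exact: FU.
apply: sigma_algebra_bigcup => n.
case: pselect => ?; last exact: sigma_algebra0.
exact: borel_refine.
Qed.

End selector.

Lemma borel_selector (R : realType) (X : metricType R) : separable X ->
  exists2 f : continuum X -> X,
    borel_map f & forall K : continuum X, (K : set X) (f K).
Proof.
move=> sX; have [[x0 _]|noX] := pselect (exists x : X, True).
  have [F [cF Fnet]] := metric_closed_net x0 sX.
  exact: borel_selector_of_net cF Fnet.
have noK (K : continuum X) : False.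
  by have [x _] := continuum_nonempty K; apply: noX; exists x.
exists (fun K => False_rect X (noK K)); last by move=> K; case: (noK K).
apply: borel_map_open => U _; rewrite (_ : _ @^-1` _ = set0).
  exact: sigma_algebra0.
by apply/seteqP; split => K; case: (noK K).
Qed.

(** * Chains of small continua against arcs of small continua, and the two reductions *)

Section main.
Context {R : realType} {X : metricType R}.
Variable eps : R.
Hypothesis eps_gt0 : 0 < eps.
Hypothesis sX : separable X.

Let Z := set_type (@small_continua R X eps).

Let Z_hausdorff : hausdorff_space Z.
Proof. exact/hausdorff_set_type/continuum_hausdorff. Qed.

Definition small_continuum (K : continuum X) (sK : small_continua eps K) : Z :=
  exist (fun K => K \in small_continua eps) K (mem_set sK).

Lemma small_singleton (x : X) : small_continua eps (singleton_continuum x).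
Proof.
rewrite /small_continua/=.
apply: (@le_lt_trans _ _ 0%:E); last by rewrite lte_fin.
by apply: diam_le => _ _ -> ->; rewrite mdistxx.
Qed.

Definition point_continuum (x : X) : Z := small_continuum (small_singleton x).

Lemma continuous_point_continuum : continuous point_continuum.
Proof.
apply: continuous_to_set_type => x; apply: cvg_vietoris => U oU.
  move=> xU; have : nbhs x U by apply: open_nbhs_nbhs; split => //; exact: xU.
  by apply: filterS => y Uy /= _ ->.
move=> [_ [-> Ux]]; have : nbhs x U by exact: open_nbhs_nbhs.
by apply: filterS => y Uy /=; exists y.
Qed.

Lemma arc_path_point (K : Z) (x : X) : (set_val K : set X) x ->
  arc_path R (point_continuum x) K.
Proof.
move=> Kx; have [a [b [h [[ab ch ih ha hb] hK]]]] := order_arc sX Kx.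
have sh t : small_continua eps (h t) := small_sub (hK t) (set_valP K).
exists a, b, (fun t => small_continuum (sh t)); split => //.
- by apply: continuous_to_set_type; exact: ch.
- by move=> s t Is It /(congr1 set_val)/=; exact: ih.
- exact: val_inj.
- exact: val_inj.
Qed.

(** Within one link, the singletons of two points are joined through the link itself; consecutive
    links are passed at a common point. *)
Lemma chain_arc_path (x y : X) : chain_rel eps x y ->
  arc_path R (point_continuum x) (point_continuum y).
Proof.
move=> [k [K [sK Kx Ky KK]]].
have link i p q : (i <= k)%N -> (K i : set X) p -> (K i : set X) q ->
    arc_path R (point_continuum p) (point_continuum q).
  move=> ik Kp Kq.
  apply: (@arc_path_trans _ _ _ (small_continuum (sK _ ik))) => //.
    exact: arc_path_point.
  by apply: arc_path_sym; exact: arc_path_point.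
suff : forall i z, (i <= k)%N -> (K i : set X) z ->
    arc_path R (point_continuum x) (point_continuum z).
  by move=> /(_ k y (leqnn k) Ky).
elim=> [|i IH] z ik Kz; first exact: (link 0%N).
have [p [Kp Kp']] := KK _ ik.
by apply: (arc_path_trans Z_hausdorff (IH p (ltnW ik) Kp)); exact: (link i.+1).
Qed.

(** The freedom in choosing [x] and [y] covers both reductions: singletons with their points in one
    direction, arbitrary small continua with selected points in the other. *)
Lemma chain_rel_arc_rel (K L : Z) (x y : X) :
  (set_val K : set X) x -> (set_val L : set X) y ->
  chain_rel eps x y <-> arc_rel R K L.
Proof.
move=> Kx Ly; rewrite arc_relP//; split.
  move=> /chain_arc_path xy.
  apply: (arc_path_trans Z_hausdorff _ (arc_path_point Ly)).
  apply: (arc_path_trans Z_hausdorff _ xy).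
  by apply: arc_path_sym; exact: arc_path_point.
move=> [a [b [g [ab cg _ gK gL]]]]; apply: (path_chain_rel ab cg).
  by rewrite gK.
by rewrite gL.
Qed.

End main.

Theorem proposition39 (R : realType) (X : metricType R) (eps : R)
    (polishX : polish R X) (eps_gt0 : 0 < eps) :
  borel_bireducible (@chain_rel R X eps)
    (@arc_rel R (set_type (@small_continua R X eps))).
Proof.
have [sX _] := polishX; split.
  exists (point_continuum eps_gt0).
    by apply: continuous_borel_map; exact: continuous_point_continuum.
  by move=> x y; exact: chain_rel_arc_rel.
have [f bf fK] := borel_selector sX.
exists (f \o set_val).
  move=> B /bf; apply: continuous_borel_map; exact: initial_continuous.
by move=> K L; apply: iff_sym; apply: chain_rel_arc_rel => //; exact: fK.
Qed.
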